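(* Suppose that $x_0,\dots,x_N\in\mathbb{R}^{n_x}$, $u_0,\dots,u_{N-1}\in\mathbb{R}^{n_u}$, $\lambda_0,\dots,\lambda_N\in\mathbb{R}^{n_x}$ and $\nu\in\mathbb{R}^{n_c}$ satisfy the first-order necessary conditions (FONC) of the transformed optimal control problem. Then there exist Lagrange multipliers $\lambda_0^*,\dots,\lambda_N^*\in\mathbb{R}^{n_x}$ and $\nu^*\in\mathbb{R}^{n_c}$ such that $x_0,\dots,x_N$, $u_0,\dots,u_{N-1}$, $\lambda_0^*,\dots,\lambda_N^*$ and $\nu^*$ satisfy the FONC of the original optimal control problem.
   Context: Notation. Subscripts denote partial derivatives: $h_x$ is the Jacobian of $h$ with respect to $x$ (a row vector if $h$ is scalar-valued). Data. Let $n,n_u,n_c,N,k$ be positive integers with $n_u\le n$, $n_c\le n$, $2\le k\le N-1$, and let $n_x=2n$. States are written $x=\begin{bmatrix} q^{\rm T} & v^{\rm T}\end{bmatrix}^{\rm T}\in\mathbb{R}^{n_x}$ with $q,v\in\mathbb{R}^n$ (generalized coordinates and velocity). The functions $\varphi:\mathbb{R}^{n_x}\to\mathbb{R}$, $L:\mathbb{R}^{n_x}\times\mathbb{R}^{n_u}\to\mathbb{R}$, $f:\mathbb{R}^{n_x}\times\mathbb{R}^{n_u}\to\mathbb{R}^{n_x}$, $\phi:\mathbb{R}^{n_x}\to\mathbb{R}^{n_c}$ are differentiable, and $\bar x\in\mathbb{R}^{n_x}$ is given. The function $f$ has the form $$f(x,u)=\begin{bmatrix} f^{(q)}(x)\\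 f^{(v)}(x,u)\end{bmatrix},\qquad f^{(q)}(x),\,f^{(v)}(x,u)\in\mathbb{R}^n,$$ and $\phi$ depends only on the generalized coordinate, i.e. $\phi_x(x)=\begin{bmatrix}\phi_q(q) & O\end{bmatrix}$ with $\phi_q(q)\in\mathbb{R}^{n_c\times n}$. Define $g(x):=\begin{bmatrix} f^{(q)}(x)\\ 0\end{bmatrix}\in\mathbb{R}^{n_x}$. Original optimal control problem: find $x_0,\dots,x_N$, $u_0,\dots,u_{N-1}$ minimizing $J=\varphi(x_N)+\sum_{i=0}^{N-1}L(x_i,u_i)$ subject to (a) $x_i+f(x_i,u_i)-x_{i+1}=0$ for $i\in\{0,\dots,N-1\}$; (b) $x_0-\bar x=0$; (c) $\phi(x_k)=0$. Transformed optimal control problem: minimize the same $J$ subject to (a), (b) and, in place of (c), (c') $\phi\bigl(x_{k-2}+f(x_{k-2},u_{k-2})+g(x_{k-2}+f(x_{k-2},u_{k-2}))\bigr)=0$. Hamiltonians: $H(x,u,\lambda):=L(x,u)+\lambda^{\rm T}f(x,u)$ and $\tilde H(x,u,\lambda,\nu):=H(x,u,\lambda)+\nu^{\rm T}\phi\bigl(x+f(x,u)+g(x+f(x,u))\bigr)$. FONC of the transformed problem (for $x_i,u_i,\lambda_i,\nu$): the constraints (a), (b), (c') hold, and - $\varphi_x^{\rm T}(x_N)-\lambda_N=0$; - $H_x^{\rm T}(x_i,u_i,\lambda_{i+1})+\lambda_{i+1}-\lambda_i=0$ and $H_u^{\rm T}(x_i,u_i,\lambda_{i+1})=0$ for all $i\in\{0,\dots,N-1\}\setminus\{k-2\}$;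 - $\tilde H_x^{\rm T}(x_{k-2},u_{k-2},\lambda_{k-1},\nu)+\lambda_{k-1}-\lambda_{k-2}=0$ and $\tilde H_u^{\rm T}(x_{k-2},u_{k-2},\lambda_{k-1},\nu)=0$. FONC of the original problem (for $x_i,u_i,\lambda_i^*,\nu^*$): the constraints (a), (b), (c) hold, and - $\varphi_x^{\rm T}(x_N)-\lambda_N^*=0$; - $H_x^{\rm T}(x_i,u_i,\lambda_{i+1}^* )+\lambda_{i+1}^*-\lambda_i^*=0$ for all $i\in\{0,\dots,N-1\}\setminus\{k\}$; - $H_x^{\rm T}(x_k,u_k,\lambda_{k+1}^* )+\phi_x^{\rm T}(x_k)\nu^*+\lambda_{k+1}^*-\lambda_k^*=0$; - $H_u^{\rm T}(x_i,u_i,\lambda_{i+1}^* )=0$ for all $i\in\{0,\dots,N-1\}$. *)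

(* Defs.v *)
From HB Require Import structures.
From mathcomp Require Import all_boot all_order all_algebra.
From mathcomp Require Import all_classical all_reals all_analysis.

Set Implicit Arguments.
Unset Strict Implicit.
Unset Printing Implicit Defensive.

Import Order.TTheory GRing.Theory Num.Theory.
Import numFieldNormedType.Exports.

Local Open Scope ring_scope.

(* Matrix of partial derivatives. The Jacobian ['J] of MathComp-Analysis acts
   on row vectors and is the transpose of the matrix used here. *)
Definition jac (R : realType) (n m : nat) (h : 'cV[R]_n -> 'cV[R]_m)
    (x : 'cV[R]_n) : 'M[R]_(m, n) :=
  \matrix_(i < m, j < n) 'D_(delta_mx j 0) (fun y => h y i 0) x.

(* Scalar-valued case: a row vector. *)
Definition grad (R : realType) (n : nat) (h : 'cV[R]_n -> R)
    (x : 'cV[R]_n) : 'rV[R]_n :=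
  \row_(j < n) 'D_(delta_mx j 0) h x.

(* In 'cV[R]_(n + n), [usubmx] is q and [dsubmx] is v. *)
Definition position_only (R : realType) (n n_c : nat)
    (phi : 'cV[R]_(n + n) -> 'cV[R]_n_c) : Prop :=
  forall q v v' : 'cV[R]_n, phi (col_mx q v) = phi (col_mx q v').

Definition dynamics (R : realType) (n n_u : nat)
    (fq : 'cV[R]_(n + n) -> 'cV[R]_n)
    (fv : 'cV[R]_(n + n) * 'cV[R]_n_u -> 'cV[R]_n)
    (z : 'cV[R]_(n + n) * 'cV[R]_n_u) : 'cV[R]_(n + n) :=
  col_mx (fq z.1) (fv z).

Definition drift (R : realType) (n : nat)
    (fq : 'cV[R]_(n + n) -> 'cV[R]_n) (x : 'cV[R]_(n + n)) : 'cV[R]_(n + n) :=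
  col_mx (fq x) 0.

Definition transformed_constraint (R : realType) (n_x n_u n_c : nat)
    (f : 'cV[R]_n_x * 'cV[R]_n_u -> 'cV[R]_n_x) (g : 'cV[R]_n_x -> 'cV[R]_n_x)
    (phi : 'cV[R]_n_x -> 'cV[R]_n_c)
    (x : 'cV[R]_n_x) (u : 'cV[R]_n_u) : 'cV[R]_n_c :=
  phi (x + f (x, u) + g (x + f (x, u))).

Definition hamiltonian (R : realType) (n_x n_u : nat)
    (L : 'cV[R]_n_x * 'cV[R]_n_u -> R)
    (f : 'cV[R]_n_x * 'cV[R]_n_u -> 'cV[R]_n_x)
    (x : 'cV[R]_n_x) (u : 'cV[R]_n_u) (lam : 'cV[R]_n_x) : R :=
  L (x, u) + (lam^T *m f (x, u)) 0 0.

Definition hamiltonian_tilde (R : realType) (n_x n_u n_c : nat)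
    (L : 'cV[R]_n_x * 'cV[R]_n_u -> R)
    (f : 'cV[R]_n_x * 'cV[R]_n_u -> 'cV[R]_n_x) (g : 'cV[R]_n_x -> 'cV[R]_n_x)
    (phi : 'cV[R]_n_x -> 'cV[R]_n_c)
    (x : 'cV[R]_n_x) (u : 'cV[R]_n_u) (lam : 'cV[R]_n_x) (nu : 'cV[R]_n_c) : R :=
  hamiltonian L f x u lam + (nu^T *m transformed_constraint f g phi x u) 0 0.

(* The finite families x_0, ..., x_N, u_0, ..., u_(N-1), lam_0, ..., lam_N are
   indexed by nat; only the entries in these ranges are constrained. *)
Record fonc_transformed (R : realType) (n_x n_u n_c N k : nat)
    (vphi : 'cV[R]_n_x -> R) (L : 'cV[R]_n_x * 'cV[R]_n_u -> R)
    (f : 'cV[R]_n_x * 'cV[R]_n_u -> 'cV[R]_n_x) (g : 'cV[R]_n_x -> 'cV[R]_n_x)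
    (phi : 'cV[R]_n_x -> 'cV[R]_n_c) (xbar : 'cV[R]_n_x)
    (x : nat -> 'cV[R]_n_x) (u : nat -> 'cV[R]_n_u)
    (lam : nat -> 'cV[R]_n_x) (nu : 'cV[R]_n_c) : Prop := FoncTransformed {
  transformed_dynamics : forall i : nat, (i < N)%N ->
    x i + f (x i, u i) - x i.+1 = 0;
  transformed_initial : x 0%N - xbar = 0;
  transformed_switching :
    transformed_constraint f g phi (x (k - 2)%N) (u (k - 2)%N) = 0;
  transformed_terminal : (grad vphi (x N))^T - lam N = 0;
  transformed_costate : forall i : nat, (i < N)%N -> i <> (k - 2)%N ->
    (grad (fun y => hamiltonian L f y (u i) (lam i.+1)) (x i))^T
      + lam i.+1 - lam i = 0;
  transformed_control : forall i : nat, (i < N)%N -> i <> (k - 2)%N ->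
    (grad (fun w => hamiltonian L f (x i) w (lam i.+1)) (u i))^T = 0;
  transformed_costate_switch :
    (grad (fun y =>
        hamiltonian_tilde L f g phi y (u (k - 2)%N) (lam (k - 1)%N) nu)
      (x (k - 2)%N))^T + lam (k - 1)%N - lam (k - 2)%N = 0;
  transformed_control_switch :
    (grad (fun w =>
        hamiltonian_tilde L f g phi (x (k - 2)%N) w (lam (k - 1)%N) nu)
      (u (k - 2)%N))^T = 0
}.

Record fonc_original (R : realType) (n_x n_u n_c N k : nat)
    (vphi : 'cV[R]_n_x -> R) (L : 'cV[R]_n_x * 'cV[R]_n_u -> R)
    (f : 'cV[R]_n_x * 'cV[R]_n_u -> 'cV[R]_n_x)
    (phi : 'cV[R]_n_x -> 'cV[R]_n_c) (xbar : 'cV[R]_n_x)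
    (x : nat -> 'cV[R]_n_x) (u : nat -> 'cV[R]_n_u)
    (lam : nat -> 'cV[R]_n_x) (nu : 'cV[R]_n_c) : Prop := FoncOriginal {
  original_dynamics : forall i : nat, (i < N)%N ->
    x i + f (x i, u i) - x i.+1 = 0;
  original_initial : x 0%N - xbar = 0;
  original_switching : phi (x k) = 0;
  original_terminal : (grad vphi (x N))^T - lam N = 0;
  original_costate : forall i : nat, (i < N)%N -> i <> k ->
    (grad (fun y => hamiltonian L f y (u i) (lam i.+1)) (x i))^T
      + lam i.+1 - lam i = 0;
  original_costate_switch :
    (grad (fun y => hamiltonian L f y (u k) (lam k.+1)) (x k))^T
      + (jac phi (x k))^T *m nu + lam k.+1 - lam k = 0;
  original_control : forall i : nat, (i < N)%N ->
    (grad (fun w => hamiltonian L f (x i) w (lam i.+1)) (u i))^T = 0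
}.

(* Main.v *)
(* Let P = diag(1, 0) be the projection onto the generalized coordinates. As phi
   depends on q only, phi = phi o P; and P f(x, u) = g(x) does not involve u.
   With y = x_(k-1), the point y + g(y) therefore has the same q as x_k, so both
   constraints coincide, and c := nu^T phi_x(x_k) satisfies c P = c, whence
   c f_x = c g_x and c f_u = 0. The multipliers
     lam*_(k-1) = lam_(k-1) + (c (1 + g_x(y)))^T,   lam*_k = lam_k + c^T,
   nu* = nu, and lam*_i = lam_i otherwise, work: at stage k-2 the correction is
   the chain-rule term of the tilde Hamiltonian, at stage k-1 the corrections
   cancel by c f_x = c g_x and c f_u = 0, and at stage k the shift of lam_k
   absorbs phi_x^T nu. *)
Require Import Defs.
From HB Require Import structures.
From mathcomp Require Import all_boot all_order all_algebra.
From mathcomp Require Import all_classical all_reals all_analysis.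
From mathcomp Require Import zify.

Set Implicit Arguments.
Unset Strict Implicit.
Unset Printing Implicit Defensive.

Import Order.TTheory GRing.Theory Num.Theory.
Import numFieldNormedType.Exports.

Local Open Scope ring_scope.

(** * Calculus rules for [jac] and [grad], derived from the Fréchet differential *)

Section Jacobian.
Context {R : realType}.

Lemma differentiable_mulmx {m n : nat} (A : 'M[R]_(m, n)) (x : 'cV[R]_n) :
  differentiable (mulmx A : 'cV[R]_n -> 'cV[R]_m) x.
Proof.
have -> : mulmx A = \sum_(i < n) (fun y : 'cV[R]_n => y i 0 *: col i A).
  apply/funext => y; rewrite fct_sumE; apply/matrixP => i j.
  by rewrite !mxE summxE; apply: eq_bigr => l _; rewrite !mxE (ord1 j) mulrC.
apply: differentiable_sum => i.
exact/differentiableZl/differentiable_coord.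
Qed.

Lemma diff_mulmx {m n : nat} (A : 'M[R]_(m, n)) (x v : 'cV[R]_n) :
  'd (mulmx A : 'cV[R]_n -> 'cV[R]_m) x v = A *m v.
Proof.
apply: (congr1 (fun f : 'cV[R]_n -> 'cV[R]_m => f v)).
by apply: diff_lin => y; apply/differentiable_continuous/differentiable_mulmx.
Qed.

(** Bridge between the entrywise directional derivatives that define [jac] and the differential: for
    a differentiable map, a directional derivative may be taken coordinate by coordinate. *)
Lemma col_jac {m n : nat} (h : 'cV[R]_n -> 'cV[R]_m) (x : 'cV[R]_n) j :
  differentiable h x -> col j (jac h x) = 'd h x (delta_mx j 0).
Proof.
move=> dh; rewrite -deriveE// derive_mx; last exact: diff_derivable.
by apply/matrixP => i l; rewrite (ord1 l) !mxE.
Qed.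

Lemma diff_jac {m n : nat} (h : 'cV[R]_n -> 'cV[R]_m) (x v : 'cV[R]_n) :
  differentiable h x -> 'd h x v = jac h x *m v.
Proof.
move=> dh; have {1}-> : v = \sum_j v j 0 *: delta_mx j 0.
  by rewrite [LHS]matrix_sum_delta; apply: eq_bigr => j _; rewrite big_ord1.
rewrite linear_sum; apply/matrixP => i l; rewrite summxE mxE (ord1 l).
apply: eq_bigr => j _; rewrite linearZ/= -col_jac//.
by rewrite !mxE mulrC.
Qed.

(** A linear map determines its matrix. This reduces the rules below for [jac] to the corresponding
    rules for ['d]. *)
Lemma jacP {m n : nat} (h : 'cV[R]_n -> 'cV[R]_m) (x : 'cV[R]_n)
    (A : 'M[R]_(m, n)) :
  differentiable h x -> (forall v, 'd h x v = A *m v) -> jac h x = A.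
Proof.
move=> dh hA; apply/matrixP => i j.
have := hA (delta_mx j 0); rewrite -col_jac// -colE => /matrixP/(_ i 0).
by rewrite !mxE.
Qed.

Lemma jac_comp {m n p : nat} (h : 'cV[R]_n -> 'cV[R]_m)
    (g : 'cV[R]_m -> 'cV[R]_p) (x : 'cV[R]_n) :
  differentiable h x -> differentiable g (h x) ->
  jac (fun y => g (h y)) x = jac g (h x) *m jac h x.
Proof.
move=> dh dg; apply: jacP; first exact: differentiable_comp.
by move=> v; rewrite diff_comp//= !diff_jac// mulmxA.
Qed.

Lemma jacD {m n : nat} (h g : 'cV[R]_n -> 'cV[R]_m) (x : 'cV[R]_n) :
  differentiable h x -> differentiable g x ->
  jac (fun y => h y + g y) x = jac h x + jac g x.
Proof.
move=> dh dg; apply: jacP; first exact: differentiableD.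
by move=> v; rewrite diffD// mulmxDl -!diff_jac.
Qed.

Lemma jac_id {n : nat} (x : 'cV[R]_n) : jac id x = 1%:M.
Proof. by apply: jacP => // v; rewrite diff_val mul1mx. Qed.

Lemma jac_cst {m n : nat} (c : 'cV[R]_m) (x : 'cV[R]_n) :
  jac (fun=> c) x = 0.
Proof.
apply: jacP; first exact: differentiable_cst.
by move=> v; rewrite diff_cst mul0mx.
Qed.

Lemma jac_mulmx {m n p : nat} (A : 'M[R]_(p, m)) (h : 'cV[R]_n -> 'cV[R]_m)
    (x : 'cV[R]_n) :
  differentiable h x -> jac (fun y => A *m h y) x = A *m jac h x.
Proof.
move=> dh; rewrite jac_comp//; last exact: differentiable_mulmx.
congr (_ *m _); apply: jacP; first exact: differentiable_mulmx.
exact: diff_mulmx.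
Qed.

Lemma gradD {n : nat} (h g : 'cV[R]_n -> R) (x : 'cV[R]_n) :
  differentiable h x -> differentiable g x ->
  grad (fun y => h y + g y) x = grad h x + grad g x.
Proof.
move=> dh dg; apply/rowP => j; rewrite !mxE deriveD//; exact: diff_derivable.
Qed.

Lemma grad_mulmx {m n : nat} (d : 'rV[R]_m) (h : 'cV[R]_n -> 'cV[R]_m)
    (x : 'cV[R]_n) :
  differentiable h x -> grad (fun y => (d *m h y) 0 0) x = d *m jac h x.
Proof.
move=> dh; rewrite -jac_mulmx//.
by apply/rowP => j; rewrite !mxE.
Qed.

Lemma differentiable_mulmx_coord {m n : nat} (d : 'rV[R]_m)
    (h : 'cV[R]_n -> 'cV[R]_m) (x : 'cV[R]_n) :
  differentiable h x -> differentiable (fun y => (d *m h y) 0 0) x.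
Proof.
move=> dh; apply: (differentiable_comp (g := fun M : 'cV[R]_1 => M 0 0)).
  apply: (differentiable_comp dh); exact: differentiable_mulmx.
exact: differentiable_coord.
Qed.

Lemma differentiable_pairl {m n : nat} {V : normedModType R}
    (h : 'cV[R]_n * 'cV[R]_m -> V) (x : 'cV[R]_n) (u : 'cV[R]_m) :
  differentiable h (x, u) -> differentiable (fun y => h (y, u)) x.
Proof.
move=> dh; apply: (differentiable_comp (f := fun y => (y, u))) => //.
Qed.

Lemma differentiable_pairr {m n : nat} {V : normedModType R}
    (h : 'cV[R]_n * 'cV[R]_m -> V) (x : 'cV[R]_n) (u : 'cV[R]_m) :
  differentiable h (x, u) -> differentiable (fun w => h (x, w)) u.
Proof.
move=> dh; apply: (differentiable_comp (f := fun w => (x, w))) => //.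
Qed.

End Jacobian.

(** * Projection onto the generalized coordinates *)

Section PositionProjection.
Context {R : realType} {n n_u n_c : nat}.

Definition position_mx : 'M[R]_(n + n) := block_mx 1%:M 0 0 0.

Lemma mul_position_mx (q v : 'cV[R]_n) :
  position_mx *m col_mx q v = col_mx q 0.
Proof. by rewrite mul_block_col !mul1mx !mul0mx !addr0. Qed.

Lemma position_mx_idem : position_mx *m position_mx = position_mx.
Proof. by rewrite mulmx_block !(mulmx0, mul0mx, mulmx1, addr0). Qed.

Lemma position_onlyE (phi : 'cV[R]_(n + n) -> 'cV[R]_n_c) :
  position_only phi -> phi = (fun y => phi (position_mx *m y)).
Proof.
move=> phiq; apply/funext => y.
by rewrite -[y]vsubmxK mul_position_mx; exact: phiq.
Qed.

(** Chain rule for [phi] composed with the projection. The right factor expresses the zero velocity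
    block of the Jacobian, and the evaluation point shows that the Jacobian itself depends on the
    position only. *)
Lemma jac_position_only (phi : 'cV[R]_(n + n) -> 'cV[R]_n_c) y :
  position_only phi -> (forall z, differentiable phi z) ->
  jac phi y = jac phi (position_mx *m y) *m position_mx.
Proof.
move=> phiq dphi; rewrite {1}(position_onlyE phiq).
rewrite (jac_comp (h := mulmx position_mx))//; last exact: differentiable_mulmx.
by rewrite (jac_mulmx _ (h := id))// jac_id mulmx1.
Qed.

Variables (fq : 'cV[R]_(n + n) -> 'cV[R]_n)
  (fv : 'cV[R]_(n + n) * 'cV[R]_n_u -> 'cV[R]_n).
Hypothesis df : forall z, differentiable (dynamics fq fv) z.

Let dfx u x : differentiable (fun y => dynamics fq fv (y, u)) x.
Proof. exact/differentiable_pairl/df. Qed.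

Let dfu u x : differentiable (fun w => dynamics fq fv (x, w)) u.
Proof. exact/differentiable_pairr/df. Qed.

(** Valid for every control [u], since the position block of the dynamics does not involve it;
    regularity and Jacobian of the drift are thereby inherited from the full dynamics. *)
Lemma driftE u : drift fq = (fun y => position_mx *m dynamics fq fv (y, u)).
Proof. by apply/funext => y; rewrite /dynamics mul_position_mx. Qed.

Lemma differentiable_drift x : differentiable (drift fq) x.
Proof.
(* The control 0 is an arbitrary choice. *)
rewrite (driftE 0); apply: differentiable_comp; first exact: dfx.
exact: differentiable_mulmx.
Qed.

Lemma jac_drift u x :
  jac (drift fq) x = position_mx *m jac (fun y => dynamics fq fv (y, u)) x.
Proof. by rewrite (driftE u) jac_mulmx. Qed.

(** As a function of the control, the projected dynamics is constant. *)
Lemma position_jac_control u x :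
  position_mx *m jac (fun w => dynamics fq fv (x, w)) u = 0.
Proof.
rewrite -jac_mulmx// -[RHS](jac_cst (drift fq x) u); congr (jac _ _).
by apply/funext => w; rewrite mul_position_mx.
Qed.

End PositionProjection.

(** * Gradients of the two Hamiltonians *)

Section Hamiltonian.
Context {R : realType} {n_x n_u n_c : nat}.
Variables (L : 'cV[R]_n_x * 'cV[R]_n_u -> R)
  (f : 'cV[R]_n_x * 'cV[R]_n_u -> 'cV[R]_n_x)
  (g : 'cV[R]_n_x -> 'cV[R]_n_x) (phi : 'cV[R]_n_x -> 'cV[R]_n_c).
Hypotheses (dL : forall z, differentiable L z)
  (df : forall z, differentiable f z) (dg : forall z, differentiable g z)
  (dphi : forall z, differentiable phi z).

Let dfx u x : differentiable (fun y => f (y, u)) x.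
Proof. exact/differentiable_pairl/df. Qed.

Let dfu u x : differentiable (fun w => f (x, w)) u.
Proof. exact/differentiable_pairr/df. Qed.

Let dHx u lam x : differentiable (fun y => hamiltonian L f y u lam) x.
Proof.
apply: differentiableD; first exact/differentiable_pairl/dL.
exact/differentiable_mulmx_coord/dfx.
Qed.

Let dHu x lam u : differentiable (fun w => hamiltonian L f x w lam) u.
Proof.
apply: differentiableD; first exact/differentiable_pairr/dL.
exact/differentiable_mulmx_coord/dfu.
Qed.

(** The Hamiltonian is affine in the multiplier. The shift is given as a row so that it multiplies
    Jacobians directly. *)
Lemma hamiltonianD x u lam (d : 'rV[R]_n_x) :
  hamiltonian L f x u (lam + d^T) =
  hamiltonian L f x u lam + (d *m f (x, u)) 0 0.
Proof. by rewrite /hamiltonian linearD/= trmxK mulmxDl mxE addrA. Qed.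

Lemma grad_hamiltonianD_state x u lam (d : 'rV[R]_n_x) :
  grad (fun y => hamiltonian L f y u (lam + d^T)) x =
  grad (fun y => hamiltonian L f y u lam) x + d *m jac (fun y => f (y, u)) x.
Proof.
under eq_fun do rewrite hamiltonianD.
rewrite gradD//; last exact: differentiable_mulmx_coord.
by rewrite grad_mulmx.
Qed.

Lemma grad_hamiltonianD_control x u lam (d : 'rV[R]_n_x) :
  grad (fun w => hamiltonian L f x w (lam + d^T)) u =
  grad (fun w => hamiltonian L f x w lam) u + d *m jac (fun w => f (x, w)) u.
Proof.
under eq_fun do rewrite hamiltonianD.
rewrite gradD//; last exact: differentiable_mulmx_coord.
by rewrite grad_mulmx.
Qed.

(** Common chain rule for the state and control gradients of [hamiltonian_tilde]: [h] becomes
    [x + f (x, u)] as a function of [x] or of [u]. *)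
Lemma jac_euler_step {m : nat} (h : 'cV[R]_m -> 'cV[R]_n_x) t :
  differentiable h t ->
  differentiable (fun s => phi (h s + g (h s))) t /\
  jac (fun s => phi (h s + g (h s))) t =
  jac phi (h t + g (h t)) *m (1%:M + jac g (h t)) *m jac h t.
Proof.
move=> dh; pose G y := y + g y.
have dG y : differentiable G y by apply: differentiableD.
have dphiG y : differentiable (phi \o G) y by exact: differentiable_comp.
split; first exact: (differentiable_comp dh (dphiG _)).
rewrite (jac_comp (h := h) (g := phi \o G))//; congr (_ *m _).
by rewrite (jac_comp (h := G))// (jacD (h := id))// jac_id.
Qed.

Lemma grad_hamiltonian_tilde_state x u lam nu (y := x + f (x, u)) :
  grad (fun z => hamiltonian_tilde L f g phi z u lam nu) x =
  grad (fun z => hamiltonian L f z u lam) x +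
  nu^T *m jac phi (y + g y) *m (1%:M + jac g y) *m
    (1%:M + jac (fun z => f (z, u)) x).
Proof.
have dh : differentiable (fun z => z + f (z, u)) x by apply: differentiableD.
have [dc jc] := jac_euler_step dh.
rewrite gradD//; last exact: differentiable_mulmx_coord.
by rewrite grad_mulmx// jc (jacD (h := id))// jac_id !mulmxA.
Qed.

Lemma grad_hamiltonian_tilde_control x u lam nu (y := x + f (x, u)) :
  grad (fun w => hamiltonian_tilde L f g phi x w lam nu) u =
  grad (fun w => hamiltonian L f x w lam) u +
  nu^T *m jac phi (y + g y) *m (1%:M + jac g y) *m jac (fun w => f (x, w)) u.
Proof.
have dh : differentiable (fun w => x + f (x, w)) u by apply: differentiableD.
have [dc jc] := jac_euler_step dh.
rewrite gradD//; last exact: differentiable_mulmx_coord.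
by rewrite grad_mulmx// jc (jacD (h := fun=> x))// jac_cst add0r !mulmxA.
Qed.

End Hamiltonian.

(** * Verification of the shifted multipliers, stage by stage *)

Theorem theorem4p1 (R : realType) (n n_u n_c N k : nat)
  (n_gt0 : (0 < n)%N) (n_u_gt0 : (0 < n_u)%N) (n_c_gt0 : (0 < n_c)%N)
  (N_gt0 : (0 < N)%N) (n_u_le : (n_u <= n)%N) (n_c_le : (n_c <= n)%N)
  (k_ge2 : (2 <= k)%N) (k_le : (k <= N - 1)%N)
  (vphi : 'cV[R]_(n + n) -> R)
  (L : 'cV[R]_(n + n) * 'cV[R]_n_u -> R)
  (fq : 'cV[R]_(n + n) -> 'cV[R]_n)
  (fv : 'cV[R]_(n + n) * 'cV[R]_n_u -> 'cV[R]_n)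
  (phi : 'cV[R]_(n + n) -> 'cV[R]_n_c)
  (xbar : 'cV[R]_(n + n))
  (vphi_diff : forall x : 'cV[R]_(n + n), differentiable vphi x)
  (L_diff : forall z : 'cV[R]_(n + n) * 'cV[R]_n_u, differentiable L z)
  (f_diff : forall z : 'cV[R]_(n + n) * 'cV[R]_n_u,
     differentiable (dynamics fq fv) z)
  (phi_diff : forall x : 'cV[R]_(n + n), differentiable phi x)
  (phi_position : position_only phi)
  (x : nat -> 'cV[R]_(n + n)) (u : nat -> 'cV[R]_n_u)
  (lam : nat -> 'cV[R]_(n + n)) (nu : 'cV[R]_n_c)
  (fonc : fonc_transformed N k vphi L (dynamics fq fv) (drift fq) phi xbar
            x u lam nu) :
  exists (lam' : nat -> 'cV[R]_(n + n)) (nu' : 'cV[R]_n_c),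
    fonc_original N k vphi L (dynamics fq fv) phi xbar x u lam' nu'.
Proof.
(* From here on the constrained stage is [k.+2], and the truncated differences in the transformed
   conditions become [k] and [k.+1]. *)
case: k k_ge2 k_le fonc => [//|[//|k]] _ k_le.
case; rewrite !subSS !subn0 => xE x0 sw xN cost ctrl cost_sw ctrl_sw.
set f := dynamics fq fv in xE cost ctrl *.
have dg z := differentiable_drift f_diff z.
have kN : (k.+2 < N)%N by lia.
have step i : (i < N)%N -> x i + f (x i, u i) = x i.+1.
  by move=> /xE/eqP; rewrite subr_eq0 => /eqP.
have x1 : x k + f (x k, u k) = x k.+1 by apply: step; lia.
have x2 : position_mx *m (x k.+1 + drift fq (x k.+1)) = position_mx *m x k.+2.
  by rewrite -(step k.+1) ?(ltnW kN)// !mulmxDr !mul_position_mx.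
pose c := nu^T *m jac phi (x k.+2).
have cP : c *m position_mx = c.
  by rewrite /c jac_position_only// -!mulmxA position_mx_idem.
(* The two evaluation points may differ in velocity, but the Jacobian only sees their projections,
   which [x2] identifies. *)
have cE : nu^T *m jac phi (x k.+1 + drift fq (x k.+1)) = c.
  by rewrite /c jac_position_only// x2 -jac_position_only.
pose a := c *m (1%:M + jac (drift fq) (x k.+1)).
pose d i := if i == k.+1 then a else if i == k.+2 then c else 0.
exists (fun i => lam i + (d i)^T), nu.
move: cost_sw ctrl_sw.
rewrite grad_hamiltonian_tilde_state// grad_hamiltonian_tilde_control//.
rewrite x1 cE -/a => cost_sw ctrl_sw.
have d0 i : i <> k.+1 -> i <> k.+2 -> d i = 0.
  by rewrite /d => /eqP/negbTE-> /eqP/negbTE->.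
have d1 : d k.+1 = a by rewrite /d eqxx.
have d2 : d k.+2 = c by rewrite /d eqxx; case: eqP => //; lia.
have cu i : c *m jac (fun w => f (x i, w)) (u i) = 0.
  by rewrite -cP -mulmxA position_jac_control// mulmx0.
split=> //.
- have := sw; rewrite /transformed_constraint x1 => {}sw.
  by rewrite -sw (position_onlyE phi_position)/= x2.
(* The terminal multiplier is unchanged because [k.+2 < N]. *)
- by rewrite d0 ?trmx0 ?addr0//; lia.
- move=> i iN ik; rewrite grad_hamiltonianD_state//.
  have [->{i iN ik}|ik0] := eqVneq i k.
    (* Of the chain-rule term [a (1 + f_x)], the part [a f_x] comes from the multiplier inside the
       Hamiltonian and the part [a] from the explicit next multiplier. *)
    rewrite d1 d0 ?trmx0 ?addr0; [|lia|lia].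
    rewrite -[RHS]cost_sw mulmxDr mulmx1 !linearD/= -!addrA.
    by rewrite -/f (addrCA _ a^T) [in RHS](addrCA a^T).
  have := cost i iN (elimN eqP ik0).
  have [->{i iN ik ik0}|ik1] := eqVneq i k.+1.
    (* The net correction is [c f_x + c - a], which vanishes since [a = c + c P f_x = c + c f_x],
       with [P] the projection. *)
    rewrite d1 d2 /a (jac_drift f_diff (u k.+1)) mulmxDr mulmx1 mulmxA cP.
    move=> <-; rewrite !linearD/= -!addrA -/f; congr (_ + _).
    rewrite (addrCA _ (lam _)) (addrCA c^T) addNKr (addrCA _ (- lam _)).
    by rewrite subrr addr0.
  by rewrite !d0 ?mul0mx ?trmx0 ?addr0//; lia.
- rewrite grad_hamiltonianD_state// d2 d0; [|lia|lia].
  rewrite mul0mx trmx0 !addr0 trmx_mul trmxK.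
  rewrite -[RHS](cost k.+2 kN); last by lia.
  by rewrite -!addrA opprD (addrCA _ (lam _)) (addrCA _ (- lam _)) subrr addr0.
- move=> i iN; rewrite grad_hamiltonianD_control//.
  (* At stage [k] the shift by [a] produces exactly the extra control term [a f_u] of the tilde
     Hamiltonian, so [ctrl_sw] applies. *)
  have [->{i iN}|ik0] := eqVneq i k; first by rewrite d1.
  rewrite linearD/= ctrl//; last exact/eqP.
  rewrite add0r.
  have [->|ik1] := eqVneq i k.+1; first by rewrite d2 cu trmx0.
  by rewrite d0 ?mul0mx ?trmx0//; lia.
Qed.
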